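(* Let $m$ and $e$ be integers such that $2\leq e\leq m$. Then $\{[S]\mid S\in\mathcal{C}(m,e)\}$ is a partition of $\mathcal{L}(m,e)$. Moreover, if $\{S,T\}\subseteq\mathcal{C}(m,e)$ and $S\neq T$, then $[S]\cap[T]=\emptyset$.
   Context: $\mathbb{N}=\{0,1,2,\ldots\}$. A numerical semigroup is a subset $S\subseteq\mathbb{N}$ closed under addition, with $0\in S$ and $\mathbb{N}\setminus S$ finite. For $A\subseteq\mathbb{N}$ nonempty, $\langle A\rangle$ is the submonoid of $(\mathbb{N},+)$ generated by $A$. The multiplicity $m(S)$ is the least positive integer in $S$. Every numerical semigroup has a unique minimal (with respect to inclusion) system of generators, which is finite; it is denoted $\mathrm{msg}(S)$, and its cardinality $e(S)$ is the embedding dimension of $S$. $\mathcal{L}(m,e)$ is the set of all numerical semigroups with multiplicity $m$ and embedding dimension $e$. A numerical semigroup $S$ is packed if $\mathrm{msg}(S)\subseteq\{m(S),m(S)+1,\ldots,2m(S)-1\}$; $\mathcal{C}(m,e)$ is the set of packed numerical semigroups in $\mathcal{L}(m,e)$. For $S\in\mathcal{L}(m,e)$, $\phi(S)$ denotes the numerical semigroup generated by $\{m+(x\bmod m)\mid x\in\mathrm{msg}(S)\}$, where $x\bmod m\in\{0,\ldots,m-1\}$ is the remainder of $x$ upon division by $m$. On $\mathcal{L}(m,e)$ define the equivalence relation $S\,\mathcal{R}\,T$ if and only if $\phi(S)=\phi(T)$, and let $[S]=\{T\in\mathcal{L}(m,e)\mid S\,\mathcal{R}\,T\}$. *)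

(* Defs.v *)
From mathcomp Require Import all_boot.
From mathcomp Require Import boolp classical_sets functions cardinality.

Set Implicit Arguments.
Unset Strict Implicit.
Unset Printing Implicit Defensive.

Local Open Scope classical_set_scope.
Local Open Scope card_scope.

Definition submonoid (M : set nat) : Prop :=
  M 0 /\ (forall x y, M x -> M y -> M (x + y)).

Definition generated (A : set nat) : set nat := smallest submonoid A.

Definition numerical_semigroup (S : set nat) : Prop :=
  submonoid S /\ cofinite_set S.

Definition is_multiplicity (S : set nat) (m : nat) : Prop :=
  [/\ S m, 0 < m & forall n, S n -> 0 < n -> m <= n].

(* The default value 0 of [xget] is never taken on a numerical semigroup,
   which always contains a positive integer. *)
Definition multiplicity (S : set nat) : nat :=
  xget 0 [set m | is_multiplicity S m].

Definition minimal_generators (S A : set nat) : Prop :=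
  generated A = S /\ (forall B, B `<=` A -> generated B = S -> B = A).

(* A numerical semigroup has exactly one minimal system of generators, so
   [xget] picks it and the default value [set0] is never taken. *)
Definition msg (S : set nat) : set nat :=
  xget set0 [set A | minimal_generators S A].

Definition semigroups_me (m e : nat) : set (set nat) :=
  [set S | [/\ numerical_semigroup S, multiplicity S = m & msg S #= `I_e]].

Definition packed (S : set nat) : Prop :=
  msg S `<=` [set x | multiplicity S <= x <= 2 * multiplicity S - 1].

Definition packed_me (m e : nat) : set (set nat) :=
  [set S | semigroups_me m e S /\ packed S].

Definition phi (m : nat) (S : set nat) : set nat :=
  generated [set m + x %% m | x in msg S].

Definition phi_equiv (m : nat) (S T : set nat) : Prop := phi m S = phi m T.

Definition phi_class (m e : nat) (S : set nat) : set (set nat) :=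
  [set T | semigroups_me m e T /\ phi_equiv m S T].

(* Main.v *)
(** The minimal generating system of a submonoid [S] of the naturals is its set
    of atoms, i.e. the positive elements that are not sums of two positive
    elements of [S]. Atoms of a semigroup of multiplicity [m] are pairwise
    incongruent modulo [m], so [x |-> m + x %% m] is injective on them; its
    image lies in [m, 2m - 1], where no element is a sum of two positive
    elements of [phi S], so this image is the set of atoms of [phi S]. Hence
    [phi] maps L(m,e) to C(m,e), and it fixes C(m,e) pointwise: the packed
    semigroups are canonical representatives of the classes. *)
Require Import Defs.
From mathcomp Require Import all_boot.
From mathcomp Require Import boolp classical_sets functions cardinality.
From mathcomp Require Import zify.

Local Open Scope classical_set_scope.

Definition atoms (S : set nat) : set nat :=
  [set x | [/\ S x, 0 < x &
    forall y z, S y -> S z -> 0 < y -> 0 < z -> x <> y + z]].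

Lemma submonoid_generated (A : set nat) : submonoid (generated A).
Proof.
split=> [B [[B0 _] _] //|x y Ax Ay B [sB AB]].
by apply: sB.2; [apply: Ax|apply: Ay].
Qed.

Lemma sub_generated (A : set nat) : A `<=` generated A.
Proof. by move=> x Ax B [_]; apply. Qed.

Lemma generated_sub {A M : set nat} :
  submonoid M -> A `<=` M -> generated A `<=` M.
Proof. by move=> sM AM x; apply. Qed.

Lemma submonoid_mul (S : set nat) (m k : nat) : submonoid S -> S m -> S (k * m).
Proof.
move=> [S0 SD] Sm; elim: k => [//|k IHk].
by rewrite mulSn; apply: SD.
Qed.

(** Strong induction: a positive non-atom splits into two smaller positive elements of [S]. *)
Lemma generated_atoms (S : set nat) : submonoid S -> generated (atoms S) = S.
Proof.
move=> sS; apply/seteqP; split; first by apply: generated_sub => // x [].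
have [g0 gD] := submonoid_generated (atoms S).
elim/ltn_ind=> x IHx Sx.
have [->//|x_gt0] := posnP x.
have [xa|nxa] := pselect (atoms S x); first exact: sub_generated.
have [y [z [Sy Sz y0 z0 xyz]]] :
    exists y z, [/\ S y, S z, 0 < y, 0 < z & x = y + z].
  apply: contrapT => nyz; apply: nxa; split=> // y z Sy Sz y0 z0 xyz.
  by apply: nyz; exists y, z.
by rewrite xyz; apply: gD; apply: IHx => //; lia.
Qed.

(** If an atom [x] were outside [A], deleting it from [generated A] would leave a submonoid that
    still contains [A]. *)
Lemma atoms_generated (A : set nat) : atoms (generated A) `<=` A.
Proof.
move=> x [gx x0 xirr]; apply: contrapT => nAx.
have [g0 gD] := submonoid_generated A.
have sAx : submonoid (generated A `\ x).
  split=> [|y z [gy yx] [gz zx]]; first by split=> //= x00; rewrite -x00 in x0.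
  split; first exact: gD.
  move=> /= yzx.
  have [y0|y0] := posnP y; first by apply: zx; rewrite /= -yzx y0.
  have [z0|z0] := posnP z; first by apply: yx; rewrite /= -yzx z0 addn0.
  exact: (xirr y z).
have AAx : A `<=` generated A `\ x.
  move=> y Ay; split; first exact: sub_generated.
  by move=> /= yx; rewrite yx in Ay.
by have [_] := generated_sub sAx AAx _ gx; apply.
Qed.

(** Every generating set contains the atoms, which themselves generate, so they form the only
    minimal generating set. *)
Lemma msg_atoms (S : set nat) : submonoid S -> msg S = atoms S.
Proof.
move=> sS; rewrite /msg; apply: xget_unique => [|B [gB minB]].
  split=> [|B BA gB]; first exact: generated_atoms.
  by apply/seteqP; split=> //; rewrite -gB; apply: atoms_generated.
apply/esym/minB; last exact: generated_atoms.
by rewrite -gB; apply: atoms_generated.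
Qed.

(** Positivity rules out the default value [0] of [xget]. *)
Lemma multiplicity_gt0P (S : set nat) :
  0 < multiplicity S -> is_multiplicity S (multiplicity S).
Proof. by rewrite /multiplicity; case: xgetP => // y ->. Qed.

Lemma multiplicity_unique (S : set nat) (m : nat) :
  is_multiplicity S m -> multiplicity S = m.
Proof.
move=> Sm; apply: xget_unique => // n Sn.
case: Sm Sn => Sm m0 minm [Sn n0 minn].
by apply/eqP; rewrite eqn_leq minn // minm.
Qed.

Lemma atoms_mod_inj (S : set nat) (m : nat) :
  submonoid S -> S m -> 0 < m ->
  {in atoms S &, injective (fun x => m + x %% m)}.
Proof.
move=> sS Sm m0.
(* The larger of two congruent atoms would be the smaller one plus a positive multiple of [m]. *)
have lt_absurd x y : atoms S x -> atoms S y -> x %% m = y %% m -> ~ x < y.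
  move=> [Sx x0 _] [_ _ yirr] xy ltxy.
  have yE : y = x + (y %/ m - x %/ m) * m.
    by have := divn_eq x m; have := divn_eq y m; rewrite mulnBl xy; lia.
  apply: (yirr _ _ _ _ _ _ yE) => //; first exact: submonoid_mul.
  by move: ltxy; rewrite {1}yE; lia.
move=> x y /set_mem xa /set_mem ya /addnI xy.
by case: (ltngtP x y) => // [/lt_absurd|/lt_absurd]; case.
Qed.

Section GeneratedInInterval.
Variables (m : nat) (A : set nat).
Hypotheses (m0 : 0 < m) (Am : A m) (Aint : A `<=` [set x | m <= x < 2 * m]).

Lemma generated_interval_ge (x : nat) : generated A x -> 0 < x -> m <= x.
Proof.
have sm : submonoid [set x | 0 < x -> m <= x].
  by split=> [//|y z /= ym zm]; lia.
by apply: (generated_sub sm) => y /Aint /=; lia.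
Qed.

Lemma multiplicity_generated_interval : multiplicity (generated A) = m.
Proof.
apply: multiplicity_unique; split=> //; first exact: sub_generated.
exact: generated_interval_ge.
Qed.

Lemma msg_generated_interval : msg (generated A) = A.
Proof.
rewrite msg_atoms; last exact: submonoid_generated.
apply/seteqP; split=> [|x Ax]; first exact: atoms_generated.
have /= xm := Aint _ Ax; split; [exact: sub_generated|lia|].
move=> y z /generated_interval_ge ym /generated_interval_ge zm y0 z0.
have := ym y0; have := zm z0; lia.
Qed.

End GeneratedInInterval.

Lemma cofinite_nat (S : set nat) (N : nat) :
  (forall n, N <= n -> S n) -> cofinite_set S.
Proof.
move=> SN; apply: (@sub_finite_set _ _ `I_N); last exact: finite_II.
by move=> n /= nSn; rewrite ltnNge; apply/negP => /SN.
Qed.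

Lemma cofinite_nat_bound (S : set nat) :
  cofinite_set S -> exists N, forall n, N <= n -> S n.
Proof.
move=> /finite_seqP[s sE]; exists (\max_(i <- s) i).+1 => n ltn.
apply: contrapT => nSn.
have ns : n \in s by have : (~` S) n by []; rewrite sE.
by have := @leq_bigmax_seq _ s xpredT id n ns isT; rewrite leqNgt ltn.
Qed.

(** [S] meets every residue class modulo [m], hence so does [T]; adding multiples of [m] to one
    representative [f r] per class reaches every large number. *)
Lemma cofinite_residues (S T : set nat) (m : nat) :
  0 < m -> submonoid T -> T m -> cofinite_set S ->
  (forall x, S x -> exists2 t, T t & t %% m = x %% m) -> cofinite_set T.
Proof.
move=> m0 sT Tm /cofinite_nat_bound[N SN] ST.
have [f fP] : {f : nat -> nat & forall r, T (f r) /\ f r %% m = r %% m}.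
  apply: (@choice _ _ (fun r t => T t /\ t %% m = r %% m)) => r.
  (* This number is congruent to [r], and at least [N] because [m] is positive. *)
  have [|t Tt tr] := ST (N * m + r); first by apply: SN; nia.
  by exists t; rewrite tr modnMDl.
apply: (@cofinite_nat _ (\max_(r < m) f r)) => n len.
have [Tf fn] := fP (n %% m); rewrite modn_mod in fn.
have fle : f (n %% m) <= n.
  exact: leq_trans (leq_bigmax (Ordinal (ltn_pmod n m0))) len.
have -> : n = f (n %% m) + (n %/ m - f (n %% m) %/ m) * m.
  have := divn_eq n m; have := divn_eq (f (n %% m)) m.
  by rewrite fn mulnBl; lia.
by apply: sT.2 => //; apply: submonoid_mul.
Qed.

Lemma packed_phi (m e : nat) (S : set nat) :
  0 < m -> semigroups_me m e S -> packed_me m e (phi m S).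
Proof.
move=> m0 [[sS cS] mS cardS].
have [Sm _ minm] : is_multiplicity S m.
  by rewrite -mS; apply: multiplicity_gt0P; rewrite mS.
rewrite /phi; set A := [set _ | _ in _].
(* [m] is an atom of [S], being its least positive element, and [m + m %% m = m]. *)
have Am : A m.
  exists m; last by rewrite modnn addn0.
  rewrite msg_atoms //; split=> // y z Sy Sz y0 z0.
  by have := minm _ Sy y0; lia.
have Aint : A `<=` [set x | m <= x < 2 * m].
  by move=> _ [x _ <-] /=; have := ltn_pmod x m0; lia.
have sT := submonoid_generated A.
have Tm := sub_generated _ _ Am.
have mT : multiplicity (generated A) = m by exact: multiplicity_generated_interval.
have msgT : msg (generated A) = A by exact: (msg_generated_interval m).
split; last by rewrite /packed mT msgT => x /Aint /=; lia.
split=> //; last first.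
  rewrite msgT; apply: card_eq_trans cardS; apply: inj_card_eq.
  by rewrite msg_atoms //; apply: atoms_mod_inj.
split=> //; apply: (cofinite_residues _ _ _ m0 sT Tm cS).
(* The numbers congruent to some element of [T] form a submonoid, so checking the generators of [S]
   suffices. *)
rewrite -[X in forall x, X x -> _](generated_atoms S) // -msg_atoms //.
apply: generated_sub => [|x Sx].
  split=> [|x y [t Tt tx] [u Tu uy]]; first by exists 0 => //; apply: sT.1.
  by exists (t + u); [apply: sT.2|rewrite -modnDm tx uy modnDm].
exists (m + x %% m); first by apply: sub_generated; exists x.
by rewrite modnDl modn_mod.
Qed.

Lemma phi_packed (m e : nat) (S : set nat) :
  0 < m -> packed_me m e S -> phi m S = S.
Proof.
move=> m0 [[[sS _] mS _]]; rewrite /packed mS => pS.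
rewrite -[RHS](generated_atoms S) // -msg_atoms // /phi; congr generated.
rewrite -[RHS]image_id; apply: eq_imagel => x /pS /= xm.
(* As [m <= x < 2 * m], the remainder of [x] is [x - m]. *)
have {1}-> : x = x - m + m by lia.
by rewrite modnDr modn_small; lia.
Qed.

Theorem theorem3 (m e : nat) (he : 2 <= e) (hem : e <= m) :
  partition [set phi_class m e S | S in packed_me m e] id (semigroups_me m e) /\
  (forall S T : set nat, packed_me m e S -> packed_me m e T -> S <> T ->
    phi_class m e S `&` phi_class m e T = set0).
Proof.
have m0 : 0 < m by lia.
split; first split.
- apply/seteqP; split=> [T [_ [S _ <-]] []//|S LS].
  have pS := packed_phi _ _ _ m0 LS.
  (* [S] lies in the class of its packed representative, since [phi] is idempotent. *)
  exists (phi_class m e (phi m S)); first by exists (phi m S).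
  by split=> //; rewrite /phi_equiv (phi_packed _ _ _ m0 pS).
- move=> _ _ [S _ <-] [T _ <-] [U [[_ SU] [_ TU]]].
  by rewrite /phi_class /phi_equiv SU TU.
- by move=> _ [S [LS _] <-]; exists S.
(* A common member [U] gives [S = phi m S = phi m U = phi m T = T]. *)
- move=> S T pS pT; apply: contra_notP => /eqP/set0P[U [[_ SU] [_ TU]]].
  by rewrite -(phi_packed _ _ _ m0 pS) SU -TU (phi_packed _ _ _ m0 pT).
Qed.
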